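(* There is an $O\left(\frac{p^3}{\log p}\log d\log r\right)$-competitive randomized online algorithm for set cover minimizing the $\ell_p$-norm of multiple cost functions, where $d$ is the maximum number of sets containing any element and $r=|U|$ is the number of elements. That is, for every instance and every sequence of arriving elements, the algorithm maintains a collection of sets covering all arrived elements such that the expected $\ell_p$-norm of its cost vector is at most $O\left(\frac{p^3}{\log p}\log d\log r\right)$ times the minimum $\ell_p$-norm of the cost vector of any collection of sets covering all arrived elements.
   Context: Online set cover with multiple costs: given up-front are $n$ sets $S_1,\dots,S_n$ over a ground set $U$, a number $p\ge1$, and $K$ linear cost functions $B_k:[n]\to\mathbb{R}_+$, $B_k(j)=b_{kj}$, $k\in[K]$. Elements of $U$ arrive online and must be covered by some selected set upon arrival; selecting a set is irrevocable. The cost vector of a collection $J\subseteq[n]$ is $\left(\sum_{j\in J}b_{kj}\right)_{k\in[K]}$, and the objective is its $\ell_p$-norm. The $O(\cdot)$ hides an absolute constant; logarithmic factors inside $O(\cdot)$ are read as quantities bounded below by a positive constant (e.g. $\log(1+\cdot)$). Competitiveness of a randomized algorithm is in expectation, for an input sequence fixed in advance. *)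

(* Defs.v *)
From HB Require Import structures.
From mathcomp Require Import all_boot all_order all_algebra.
From mathcomp Require Import all_classical all_reals all_analysis.

Set Implicit Arguments.
Unset Strict Implicit.
Unset Printing Implicit Defensive.

Import Order.TTheory GRing.Theory Num.Theory.
Import numFieldNormedType.Exports.

Local Open Scope classical_set_scope.
Local Open Scope ring_scope.

(* The data given up-front, all of it known to the algorithm. *)
Record instance (R : realType) := Instance {
  ground : finType;
  nsets : nat;
  sets : 'I_nsets -> {set ground};
  expo : R;
  expo_ge1 : 1 <= expo;
  ncosts : nat;
  cost : 'I_ncosts -> 'I_nsets -> R;
  cost_ge0 : forall k j, 0 <= cost k j
}.

Section Offline.
Variables (R : realType) (I : instance R).

Definition cost_vector (J : {set 'I_(nsets I)}) : 'I_(ncosts I) -> R :=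
  fun k => \sum_(j in J) cost k j.

Definition lp_norm (p : R) (K : nat) (x : 'I_K -> R) : R :=
  (\sum_(k < K) `|x k| `^ p) `^ p^-1.

Definition objective (J : {set 'I_(nsets I)}) : R :=
  lp_norm (expo I) (cost_vector J).

Definition covers (J : {set 'I_(nsets I)}) (s : seq (ground I)) : bool :=
  all (fun e => [exists j in J, e \in sets j]) s.

Definition coverable (s : seq (ground I)) : bool := covers [set: 'I_(nsets I)]%SET s.

(* A genuine minimum as soon as [coverable s], since then the default
   candidate, the collection of all sets, is feasible. *)
Definition opt (s : seq (ground I)) : R :=
  objective [arg min_(J < [set: 'I_(nsets I)]%SET | covers J s) objective J]%O.

Definition max_frequency : nat :=
  (\max_(e : ground I) #|[set j | e \in sets j]%SET|)%N.

(* p^3 / log p * log d * log r, every logarithm being read as log (1 + _)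
   so that it stays bounded away from 0 when p, d or r equals 1. *)
Definition ratio_bound : R :=
  expo I ^+ 3 / ln (1 + expo I) * ln (1 + max_frequency%:R)
    * ln (1 + #|ground I|%:R).

End Offline.

(* A probability distribution over deterministic online algorithms:
   [select w s] is the collection held, on random outcome [w], once exactly the
   elements of [s] have arrived, in this order. Being a function of that prefix
   alone, it cannot depend on later arrivals. Covering is required on every
   outcome, for every sequence that can be covered at all. *)
Record online_algorithm (R : realType) (I : instance R) := OnlineAlgorithm {
  disp : measure_display;
  outcome : measurableType disp;
  law : probability outcome R;
  select : outcome -> seq (ground I) -> {set 'I_(nsets I)};
  select_measurable : forall s (J : {set 'I_(nsets I)}),
    measurable [set w | select w s = J];
  select_irrevocable : forall w s e,
    select w s \subset select w (rcons s e);
  select_covers : forall w s, coverable s -> covers (select w s) s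
}.
Arguments select {R I} _ _ _.

(* The sequence is quantified outside the expectation: it is fixed in advance
   and does not depend on the random outcome. *)
Definition competitive (R : realType) (rho : instance R -> R)
    (alg : forall I : instance R, online_algorithm I) : Prop :=
  forall (I : instance R) (s : seq (ground I)), coverable s ->
    ('E_(law (alg I))[fun w => objective (select (alg I) w s)]
       <= (rho I * opt s)%:E)%E.

(* Main.v *)
Require Import Defs.
From HB Require Import structures.
From mathcomp Require Import all_boot all_order all_algebra.
From mathcomp Require Import all_classical all_reals all_analysis.
From mathcomp Require Import ring lra zify.

(* A fractional cover x on the grid (1/N)Z, N = q d with q >= p, is maintained
   by a primal-dual scheme for the convex potential
     F(x) = sum_k (Bx)_k^p + sum_j c_j x_j,   c_j = sum_k b_kj^p.
   While an arrived element e has fractional coverage below 1, its dual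
   variable is raised until some set j containing e has received the load
   G_j(x) / (m_j + q) since its last increment, where x_j = m_j / N and G_j
   bounds the discrete derivative of F; then x_j grows by 1/N.  Loads telescope
   to a harmonic sum, so weak duality gives F(x) <= O(log d) sum_(j in J) G_j(x)
   for every cover J, and Young's inequality turns this into
   F(x)^(1/p) <= O(p log d) OPT.

   The rounding compares lambda x_j, lambda ~ log r, with independent uniform
   thresholds, and buys the best single-element cover of any element missed at
   its arrival: each is missed with probability at most 1/(1+r), so these
   purchases cost at most OPT on average.  For a sum Z of independent terms
   b_j X_j of mean mu, expanding Z^p = sum_j b_j X_j Z^(p-1) gives
   E Z^p <= O(mu)^p + O(p)^p sum_j b_j^p P(X_j = 1), whose last term is what the
   linear part of F controls.  The total factor O(p^2 log d log r) is within the
   claimed bound since log (1 + p) <= p. *)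

Set Implicit Arguments.
Unset Strict Implicit.
Unset Printing Implicit Defensive.

Import Order.TTheory GRing.Theory Num.Theory.

Local Open Scope ring_scope.

(** * Inequalities for real powers *)

Section PowerInequalities.
Variable R : realType.
Implicit Types a b p q s t u v x : R.

Lemma ge0_leq_powR p a b : 0 <= p -> 0 <= a -> a <= b -> a `^ p <= b `^ p.
Proof.
move=> p0 a0 ab; apply: ge0_ler_powR => //; rewrite nnegrE //.
exact: le_trans ab.
Qed.

Lemma powR_mulr_pred a p : 0 <= a -> 1 <= p -> a `^ p = a * a `^ (p - 1).
Proof.
move=> a0 p1; rewrite -{2}(powRr1 a0) -powRD subrKC//.
by rewrite gt_eqF ?(lt_le_trans _ p1).
Qed.

Lemma powRD_superadd a b p : 0 <= a -> 0 <= b -> 1 <= p ->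
  a `^ p + b `^ p <= (a + b) `^ p.
Proof.
move=> a0 b0 p1.
rewrite (powR_mulr_pred a0 p1) (powR_mulr_pred b0 p1).
rewrite (powR_mulr_pred (addr_ge0 a0 b0) p1) mulrDl.
have q0 : 0 <= p - 1 by rewrite subr_ge0.
by apply: lerD; apply: ler_wpM2l => //; apply: ge0_leq_powR => //;
  rewrite ?lerDl ?lerDr.
Qed.

Lemma powR_sum_superadd (I : finType) (P : pred I) (F : I -> R) p :
  1 <= p -> (forall i, 0 <= F i) ->
  \sum_(i | P i) F i `^ p <= (\sum_(i | P i) F i) `^ p.
Proof.
move=> p1 F0.
suff [] : \sum_(i | P i) F i `^ p <= (\sum_(i | P i) F i) `^ p /\
          0 <= \sum_(i | P i) F i by [].
apply: (big_ind2 (fun x y => x <= y `^ p /\ 0 <= y)) => //.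
move=> x1 x2 y1 y2 [h1 p1'] [h2 p2']; split; last exact: addr_ge0.
by apply: le_trans (powRD_superadd p1' p2' p1); exact: lerD.
Qed.

(* Bernoulli for the ratio [s = a / (a + b) = expR v]: combine
   [expR ((p - 1) * v) >= 1 + (p - 1) * v] with [expR (- v) >= 1 - v]. *)
Lemma powR_increment a b p : 0 <= a -> 0 <= b -> 1 <= p ->
  (a + b) `^ p - a `^ p <= p * b * (a + b) `^ (p - 1).
Proof.
rewrite le_eqVlt => /predU1P[<-|a0] b0 p1.
  rewrite add0r powR0 ?gt_eqF ?(lt_le_trans _ p1)// subr0 powR_mulr_pred//.
  rewrite -mulrA ler_peMl// mulr_ge0 ?powR_ge0//.
have T0 : 0 < a + b by rewrite ltr_wpDr.
set T := a + b in T0 *; set v := ln (a / T).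
have aE : a = T * expR v by rewrite /v lnK ?posrE ?divr_gt0// mulrCA divff ?mulr1 ?gt_eqF.
have aP : a `^ p = T `^ p * expR (p * v).
  rewrite {1}aE powRM ?expR_ge0 ?ltW//.
  by rewrite /powR (gt_eqF (expR_gt0 _)) expRK.
have bE : b = T * (1 - expR v) by rewrite mulrBr mulr1 -aE /T addrAC subrr add0r.
have h1 : 1 + p * (expR v - 1) <= expR (p * v).
  have -> : p * v = v + (p - 1) * v by ring.
  rewrite expRD.
  have h2 : expR v * (1 + (p - 1) * v) <= expR v * expR ((p - 1) * v).
    by rewrite ler_wpM2l ?expR_ge0 ?expR_ge1Dx.
  have h3 : expR v * (1 - v) <= 1.
    by rewrite -[leRHS](expRxMexpNx_1 v) ler_wpM2l ?expR_ge0// expR_ge1Dx.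
  have h4 : (p - 1) * (expR v * (1 - v)) <= (p - 1) * 1.
    by rewrite ler_wpM2l ?subr_ge0.
  apply: le_trans h2; lra.
rewrite aP {1}bE.
have -> : p * (T * (1 - expR v)) * T `^ (p - 1) = T `^ p * (p * (1 - expR v)).
  by rewrite (powR_mulr_pred (ltW T0) p1); ring.
rewrite -[X in X - _]mulr1 -mulrBr ler_wpM2l ?powR_ge0//.
lra.
Qed.

(** If [q * b <= a], the factor [(1 + 1/q)^q <= e] gives the first term; otherwise [a + b] is below
    [(1 + q) * b]. *)
Lemma powRD_split a b q : 0 <= a -> 0 <= b -> 0 <= q ->
  (a + b) `^ q <= expR 1 * a `^ q + ((1 + q) * b) `^ q.
Proof.
move=> a0 b0 q0.
have [q_eq0|qN0] := eqVneq q 0.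
  rewrite q_eq0 !powRr0 mulr1 lerDr expR_ge0//.
have q_gt0 : 0 < q by rewrite lt0r qN0.
have [ab|ab] := leP (q * b) a.
  have h : a + b <= a * (1 + q^-1).
    by rewrite mulrDr mulr1 lerD2l ler_pdivlMr// mulrC.
  apply: le_trans (_ : (a * (1 + q^-1)) `^ q <= _).
    by apply: ge0_leq_powR => //; rewrite addr_ge0.
  rewrite powRM ?addr_ge0 ?invr_ge0//.
  rewrite mulrC ler_wpDr ?powR_ge0// ler_wpM2r ?powR_ge0//.
  rewrite /powR gt_eqF ?ltr_wpDr ?invr_ge0// ler_expR.
  rewrite -[leRHS](mulfV qN0) ler_wpM2l//.
  by rewrite le_ln1Dx// (lt_le_trans (ltrN10 R))// invr_ge0.
rewrite ler_wpDl ?mulr_ge0 ?expR_ge0 ?powR_ge0//.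
by apply: ge0_leq_powR; [|rewrite addr_ge0|rewrite mulrDl mul1r addrC lerD2l ltW].
Qed.

(** A crude Young inequality, by comparing [u] with [2 * v]. The coefficient 1/2 lets later
    estimates absorb the [u] term. *)
Lemma powR_young u v p : 0 <= u -> 0 <= v -> 1 <= p ->
  v * u `^ (p - 1) <= 2^-1 * u `^ p + (2 * v) `^ p.
Proof.
move=> u0 v0 p1.
have q0 : 0 <= p - 1 by rewrite subr_ge0.
have [uv|uv] := leP (2 * v) u.
  rewrite ler_wpDr ?powR_ge0// (powR_mulr_pred u0 p1) mulrA ler_wpM2r ?powR_ge0//.
  lra.
rewrite ler_wpDl ?mulr_ge0 ?invr_ge0 ?powR_ge0//.
rewrite [leRHS]powR_mulr_pred ?mulr_ge0//.
apply: ler_pM; rewrite ?powR_ge0//; first lra.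
by apply: ge0_leq_powR => //; exact: ltW.
Qed.

(** A bound on the root that is linear, hence stable under averaging; it stands in for Jensen's
    inequality. *)
Lemma powR_inv_le1D s p : 0 <= s -> 1 <= p -> s `^ p^-1 <= 1 + s.
Proof.
move=> s0 p1; have p0 : 0 < p by exact: lt_le_trans p1.
have [s1|s1] := leP s 1.
  rewrite ler_wpDr//; apply: le_trans (_ : 1 `^ p^-1 <= _).
    by apply: ge0_leq_powR => //; rewrite invr_ge0 ltW.
  by rewrite powR1.
rewrite ler_wpDl// -[leRHS](powRr1 s0); apply: ler_powR; first exact: ltW.
by rewrite invf_le1.
Qed.

Lemma powR_inv_powR a p : 0 <= a -> 1 <= p -> (a `^ p) `^ p^-1 = a.
Proof.
by move=> a0 p1; rewrite -powRrM mulfV ?powRr1// gt_eqF// (lt_le_trans _ p1).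
Qed.

Lemma powR_powR_inv a p : 0 <= a -> 1 <= p -> (a `^ p^-1) `^ p = a.
Proof. by move=> a0 p1; rewrite powRAC powR_inv_powR. Qed.

Lemma ln2_ge_half : 2^-1 <= ln 2 :> R.
Proof.
have := @le_ln1Dx R (- 2^-1).
have -> : 1 + - 2^-1 = 2^-1 :> R by lra.
rewrite lnV ?posrE// => /(_ _); suff : -1 < - 2^-1 :> R by lra.
lra.
Qed.

Lemma ln1Dn_ge_half n : (0 < n)%N -> 2^-1 <= ln (1 + n%:R) :> R.
Proof.
move=> n0; apply: le_trans ln2_ge_half _.
rewrite ler_ln ?posrE// ?ltr_wpDr//.
by have -> : 2 = 1 + 1%:R :> R by []; rewrite lerD2l ler_nat.
Qed.

Lemma harmonic_le_ln (q N : nat) : (0 < q)%N ->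
  \sum_(t < N.+1) ((t + q)%:R)^-1 <= 1 + ln ((N + q)%:R / q%:R) :> R.
Proof.
move=> q0; have q0' : 0 < q%:R :> R by rewrite ltr0n.
elim: N => [|N IH].
  by rewrite big_ord1 !add0n divff ?gt_eqF// ln1 addr0 invf_le1// ler1n.
rewrite big_ord_recr /=.
set x := (N.+1 + q)%:R : R.
have x1 : (N + q)%:R = x - 1 :> R by rewrite /x addSn -natr1; ring.
have x2 : 1 < x by rewrite /x addSn ltr1n ltnS addn_gt0 q0 orbT.
have x0 : 0 < x by lra.
have y0 : 0 < x - 1 by lra.
rewrite x1 in IH.
rewrite ln_div ?posrE// in IH.
(* This yields [1/x <= ln x - ln (x - 1)], so the bounds telescope. *)
have := @le_ln1Dx R (- x^-1).
have -> : 1 - x^-1 = (x - 1) / x by rewrite mulrBl divff ?mul1r ?gt_eqF.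
rewrite ln_div ?posrE// => h.
have h' : -1 < - x^-1 by rewrite ltrN2 invf_lt1.
rewrite ln_div ?posrE//; have := h h'; lra.
Qed.

End PowerInequalities.

(** * The objective *)

Lemma powR_convex_sum (R : realType) (a b s t p : R) :
  0 <= a -> 0 <= b -> 0 <= s -> 0 <= t -> s + t = 1 -> 1 <= p ->
  (s * a + t * b) `^ p <= s * a `^ p + t * b `^ p.
Proof.
move=> a0 b0 s0 t0 st p1.
have s1 : s <= 1 by lra.
have tE : t = 1 - s by lra.
have ain : a \in (`[0, +oo[%classic : set R) by rewrite inE /= in_itv /= a0.
have bin : b \in (`[0, +oo[%classic : set R) by rewrite inE /= in_itv /= b0.
by rewrite tE; exact: (convex_powR p1 (Itv01 s0 s1) ain bin).
Qed.

(** Minkowski's inequality for balls: the normalised vectors [x / a] and [y / b] are combined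
    convexly with weights [a / (a + b)] and [b / (a + b)]. *)
Lemma lp_ball_add (R : realType) (K : nat) (x y : 'I_K -> R) (a b p : R) :
  1 <= p -> 0 < a -> 0 < b -> (forall k, 0 <= x k) -> (forall k, 0 <= y k) ->
  \sum_k x k `^ p <= a `^ p -> \sum_k y k `^ p <= b `^ p ->
  \sum_k (x k + y k) `^ p <= (a + b) `^ p.
Proof.
move=> p1 a0 b0 x0 y0 hx hy.
have ab0 : 0 < a + b by rewrite addr_gt0.
have scale c u : 0 < c -> 0 <= u -> (u / c) `^ p = u `^ p / c `^ p.
  move=> c0 u0; have c0' := ltW c0.
  rewrite powRM ?invr_ge0//; congr (_ * _).
  by rewrite -(powR_inv1 c0') powRAC powR_inv1 ?powR_ge0.
have term k : (x k + y k) `^ p <= (a + b) `^ p *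
    (a / (a + b) * (x k `^ p / a `^ p) + b / (a + b) * (y k `^ p / b `^ p)).
  have -> : x k + y k = (a + b) * (a / (a + b) * (x k / a) + b / (a + b) * (y k / b)).
    by field; rewrite !gt_eqF.
  rewrite powRM ?(ltW ab0)//; last first.
    by rewrite addr_ge0 ?mulr_ge0 ?invr_ge0 ?(ltW a0) ?(ltW b0) ?(ltW ab0).
  rewrite ler_wpM2l ?powR_ge0// -!scale//.
  apply: powR_convex_sum => //; rewrite ?divr_ge0 ?(ltW a0) ?(ltW b0) ?(ltW ab0)//.
  by rewrite -mulrDl divff ?gt_eqF.
apply: le_trans (ler_sum _ (fun k _ => term k)) _.
rewrite -mulr_sumr -[leRHS]mulr1 ler_wpM2l ?powR_ge0//.
rewrite big_split /= -!mulr_sumr -!mulr_suml.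
have -> : 1 = a / (a + b) * 1 + b / (a + b) * 1 :> R.
  by rewrite !mulr1 -mulrDl divff ?gt_eqF.
apply: lerD; rewrite ler_wpM2l ?divr_ge0 ?(ltW a0) ?(ltW b0) ?(ltW ab0)//;
  by rewrite ler_pdivrMr ?powR_gt0// mul1r.
Qed.

Section Objective.
Variables (R : realType) (I : instance R).
Local Notation p := (expo I).
Local Notation n := (nsets I).
Local Notation K := (ncosts I).

Lemma expo_gt0 : 0 < p.
Proof. exact: lt_le_trans (expo_ge1 I). Qed.

Lemma cost_vector_ge0 (J : {set 'I_n}) k : 0 <= cost_vector J k.
Proof. by apply: sumr_ge0 => j _; exact: cost_ge0. Qed.

Lemma lp_norm_ge0 (q : R) m (x : 'I_m -> R) : 0 <= lp_norm q x.
Proof. exact: powR_ge0. Qed.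

Definition power_cost (J : {set 'I_n}) : R := \sum_(k < K) cost_vector J k `^ p.

Lemma power_cost_ge0 J : 0 <= power_cost J.
Proof. by apply: sumr_ge0 => k _; exact: powR_ge0. Qed.

Lemma objectiveE J : objective J = power_cost J `^ p^-1.
Proof.
rewrite /objective /lp_norm; congr (_ `^ _); apply: eq_bigr => k _.
by rewrite ger0_norm ?cost_vector_ge0.
Qed.

Lemma objective_powR J : objective J `^ p = power_cost J.
Proof. by rewrite objectiveE powR_powR_inv ?power_cost_ge0 ?expo_ge1. Qed.

Lemma objective_le_powR J (a : R) : 0 <= a -> power_cost J <= a `^ p ->
  objective J <= a.
Proof.
move=> a0 h; rewrite objectiveE -[leRHS](powR_inv_powR a0 (expo_ge1 I)).
by apply: ge0_leq_powR => //; rewrite ?power_cost_ge0// invr_ge0 ltW ?expo_gt0.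
Qed.

Lemma power_cost_le_powR J (a : R) : objective J <= a ->
  power_cost J <= a `^ p.
Proof.
move=> h; rewrite -objective_powR; apply: ge0_leq_powR => //.
  exact: ltW expo_gt0.
exact: lp_norm_ge0.
Qed.

Lemma cost_vectorU (A B : {set 'I_n}) k :
  cost_vector (A :|: B) k <= cost_vector A k + cost_vector B k.
Proof.
rewrite /cost_vector (big_setID A) /=; apply: lerD.
  by rewrite finset.setUK.
rewrite finset.setDUl finset.setDv finset.set0U [leRHS](big_setID A) /=.
by rewrite ler_wpDl// sumr_ge0// => j _; exact: cost_ge0.
Qed.

Lemma objectiveU (A B : {set 'I_n}) :
  objective (A :|: B) <= objective A + objective B.
Proof.
(* [lp_ball_add] needs positive radii, which an arbitrarily small [e] provides even when an
   objective is 0. *)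
apply/ler_addgt0Pr => e e0.
have e2 : 0 < e / 2 by rewrite divr_gt0.
have h (J : {set 'I_n}) : 0 < objective J + e / 2 by rewrite ltr_wpDl// lp_norm_ge0.
have hle J : power_cost J <= (objective J + e / 2) `^ p.
  by apply: power_cost_le_powR; rewrite lerDl ltW.
have -> : objective A + objective B + e =
  (objective A + e / 2) + (objective B + e / 2) by rewrite addrACA -splitr.
apply: objective_le_powR; first by rewrite addr_ge0// ltW.
refine (le_trans _ (lp_ball_add (expo_ge1 I) (h A) (h B) (cost_vector_ge0 A)
  (cost_vector_ge0 B) (hle A) (hle B))).
apply: ler_sum => k _; apply: ge0_leq_powR; first exact: ltW (expo_gt0).
  exact: cost_vector_ge0.
exact: cost_vectorU.
Qed.

Lemma objective0 : objective (finset.set0 : {set 'I_n}) = 0.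
Proof.
rewrite objectiveE /power_cost big1 ?powR0 ?invr_neq0 ?gt_eqF ?expo_gt0//.
by move=> k _; rewrite /cost_vector big_set0 powR0 ?gt_eqF ?expo_gt0.
Qed.

Lemma objective_bigcup (E : finType) (P : pred E) (B : E -> {set 'I_n}) :
  objective (\bigcup_(e | P e) B e)%SET <= \sum_(e | P e) objective (B e).
Proof.
apply: (big_ind2 (fun A x => objective A <= x)) => //.
  by rewrite objective0.
move=> A x B' y hA hB; apply: le_trans (objectiveU _ _) _; exact: lerD.
Qed.

Lemma optP (s : seq (ground I)) : coverable s ->
  exists2 J : {set 'I_n}, covers J s /\ objective J = opt s &
    forall J', covers J' s -> opt s <= objective J'.
Proof.
rewrite /coverable => cs.
pose P (J : {set 'I_n}) := covers J s.
have := @Order.TotalTheory.arg_minP _ _ _ _ P (@objective R I) cs.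
rewrite -/(opt s); rewrite /opt; set J0 := Order.arg_min _ _ _.
by case=> J cJ Jmin; exists J.
Qed.

End Objective.

(** * The fractional algorithm *)

Section Fractional.
Variables (R : realType) (I : instance R) (q d : nat).
Local Notation p := (expo I).
Local Notation n := (nsets I).
Local Notation K := (ncosts I).
Local Notation N := (q * d)%N.
Implicit Types (m : 'I_n -> nat) (l : 'I_n -> R) (e : ground I).
Implicit Types (st : ('I_n -> nat) * ('I_n -> R)) (J : {set 'I_n}).

Definition frac_load m k : R := \sum_j cost k j * ((m j)%:R / N%:R).

Definition power_price (j : 'I_n) : R := \sum_(k < K) cost k j `^ p.

Definition potential m : R :=
  \sum_k frac_load m k `^ p + \sum_j power_price j * ((m j)%:R / N%:R).

(* An upper bound on the discrete derivative, chosen monotone in [m]; being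
   discrete, it needs no smoothness of [t `^ p] at 0. *)
Definition slope m j : R :=
  p * (\sum_k cost k j * (frac_load m k + cost k j / N%:R) `^ (p - 1))
  + power_price j.

Definition increment m (j : 'I_n) : 'I_n -> nat := fun i => (m i + (i == j))%N.

Definition deadline m j : R := slope m j / (m j + q)%:R.

Definition slack st j : R := deadline st.1 j - st.2 j.

Definition filled e m : bool := (N <= \sum_(j | e \in sets j) m j)%N.

Definition tightest e st (j : 'I_n) : bool :=
  (e \in sets j) && [forall i, (e \in sets i) ==> (slack st j <= slack st i)].

(** Only the accumulated loads are stored, not the dual variables. The load of [j] restarts at 0;
    what it discharged is accounted for by [shifted_harmonic]. *)
Definition raise_and_increment e st (j : 'I_n) : ('I_n -> nat) * ('I_n -> R) :=
  (increment st.1 j, fun i => if i == j then 0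
                         else if e \in sets i then st.2 i + slack st j
                         else st.2 i).

Definition step e st : ('I_n -> nat) * ('I_n -> R) :=
  if filled e st.1 then st
  else if [pick j | tightest e st j] is Some j then raise_and_increment e st j
  else st.

(** While a coverable [e] is unfilled, each step adds one grid unit to its coverage, so [N] steps
    suffice. *)
Definition arrive st e := iter N (step e) st.

Definition run (s : seq (ground I)) :=
  foldl arrive ((fun=> 0%N), (fun=> 0)) s.

(** Times the current slope, this bounds the loads discharged in [i] increments, because slopes only
    grow. *)
Definition shifted_harmonic (i : nat) : R := \sum_(t < i) ((t + q)%:R)^-1.

(* [J] is any cover of the arrived elements. As [(m j + q) / N] is [x_j + 1/d],
   raising the loads of the at most [d] sets containing an uncovered element
   increases the left-hand side by at most [2 N] times the raise. *)
Definition invariant J st : Prop :=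
  [/\ forall j, (st.1 j <= N)%N,
      forall j, 0 <= st.2 j <= deadline st.1 j &
      N%:R * potential st.1 + \sum_j (st.1 j + q)%:R * st.2 j
      <= 2 * N%:R * \sum_(j in J) (slope st.1 j * shifted_harmonic (st.1 j) + st.2 j)].

Lemma step_grows e st j : (st.1 j <= (step e st).1 j)%N.
Proof.
rewrite /step; case: ifP => // _; case: pickP => // i _ /=.
by rewrite /increment leq_addr.
Qed.

Lemma arrive_grows e st j : (st.1 j <= (arrive st e).1 j)%N.
Proof.
rewrite /arrive; elim: N => //= k IH; apply: leq_trans IH _.
exact: step_grows.
Qed.

Lemma run_rcons s e : run (rcons s e) = arrive (run s) e.
Proof. by rewrite /run foldl_rcons. Qed.

Lemma run_take_grows s i j : ((run (take i s)).1 j <= (run s).1 j)%N.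
Proof.
rewrite -[in leqRHS](cat_take_drop i s) /run foldl_cat.
elim: (drop i s) (foldl _ _ _) => //= e s' IH st.
by apply: leq_trans (IH _); exact: arrive_grows.
Qed.

Hypotheses (q_gt0 : (0 < q)%N) (d_gt0 : (0 < d)%N).

Let N_gt0 : (0 < N)%N. Proof. by rewrite muln_gt0 q_gt0. Qed.
Let NR_gt0 : 0 < N%:R :> R. Proof. by rewrite ltr0n. Qed.
Let p1 : 1 <= p. Proof. exact: expo_ge1. Qed.
Let p_gt0 : 0 < p. Proof. exact: expo_gt0. Qed.

Lemma frac_load_ge0 m k : 0 <= frac_load m k.
Proof.
by apply: sumr_ge0 => j _; rewrite mulr_ge0 ?divr_ge0 ?cost_ge0.
Qed.

Lemma power_price_ge0 j : 0 <= power_price j.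
Proof. by apply: sumr_ge0 => k _; exact: powR_ge0. Qed.

Lemma slope_ge0 m j : 0 <= slope m j.
Proof.
rewrite addr_ge0 ?power_price_ge0// mulr_ge0 ?(ltW p_gt0)//.
by apply: sumr_ge0 => k _; rewrite mulr_ge0 ?powR_ge0 ?cost_ge0.
Qed.

Lemma frac_load_le m m' k : (forall j, m j <= m' j)%N ->
  frac_load m k <= frac_load m' k.
Proof.
move=> mm'; apply: ler_sum => j _; rewrite ler_wpM2l ?cost_ge0//.
by rewrite ler_wpM2r ?invr_ge0// ler_nat.
Qed.

Lemma slope_le m m' j : (forall i, m i <= m' i)%N -> slope m j <= slope m' j.
Proof.
move=> mm'; rewrite lerD2r ler_wpM2l ?(ltW p_gt0)//.
apply: ler_sum => k _; rewrite ler_wpM2l ?cost_ge0//.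
apply: ge0_leq_powR; first by rewrite subr_ge0.
  by rewrite addr_ge0 ?frac_load_ge0 ?divr_ge0 ?cost_ge0.
by rewrite lerD2r frac_load_le.
Qed.

Lemma sum_increment (F : 'I_n -> R) m j :
  \sum_i F i * ((increment m j i)%:R / N%:R) =
  \sum_i F i * ((m i)%:R / N%:R) + F j / N%:R.
Proof.
under eq_bigr => i _ do rewrite /increment natrD mulrDl mulrDr.
rewrite big_split /=; congr (_ + _); rewrite (bigD1 j) //= eqxx mul1r.
by rewrite big1 ?addr0// => i /negbTE ->; rewrite mul0r mulr0.
Qed.

Lemma potential_increment m j :
  N%:R * potential (increment m j) <= N%:R * potential m + slope m j.
Proof.
have NN : N%:R != 0 :> R by rewrite gt_eqF.
set S := \sum_k cost k j * (frac_load m k + cost k j / N%:R) `^ (p - 1).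
have powers : \sum_k frac_load (increment m j) k `^ p <=
    \sum_k frac_load m k `^ p + p * S / N%:R.
  rewrite /S mulrAC mulr_sumr -big_split /=.
  apply: ler_sum => k _; rewrite /frac_load sum_increment -/(frac_load m k).
  have := @powR_increment R (frac_load m k) (cost k j / N%:R) p
    (frac_load_ge0 m k) _ p1.
  rewrite divr_ge0 ?cost_ge0// => /(_ isT).
  rewrite lerBlDl => /le_trans -> //.
  by rewrite lerD2l !mulrA (mulrAC p).
have -> : slope m j = N%:R * (p * S / N%:R + power_price j / N%:R).
  by rewrite -mulrDl mulrCA divff ?mulr1.
rewrite -mulrDr ler_wpM2l// /potential sum_increment.
lra.
Qed.

Lemma shifted_harmonic_ge0 i : 0 <= shifted_harmonic i.
Proof. by apply: sumr_ge0 => t _; rewrite invr_ge0. Qed.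

Lemma deadline_le m m' j : (forall i, m i <= m' i)%N -> m' j = m j ->
  deadline m j <= deadline m' j.
Proof.
by move=> mm' e; rewrite /deadline e ler_wpM2r ?invr_ge0// slope_le.
Qed.

Hypothesis freq : forall e, (#|[set j | e \in sets j]%SET| <= d)%N.

Lemma increment_grows m j i : (m i <= increment m j i)%N.
Proof. exact: leq_addr. Qed.

(** The move is split in two. Raising the loads to [l1] keeps the inequality because [J] has a set
    containing [e]; the increment then trades the load of [j] for growth of the potential. *)
Lemma invariant_raise_and_increment J e st j : (exists2 i, i \in J & e \in sets i) ->
  ~~ filled e st.1 -> tightest e st j -> invariant J st ->
  invariant J (raise_and_increment e st j).
Proof.
case: st => m l [i0 i0J ei0]; rewrite /filled -ltnNge /= => notfull.
case/andP => ej /forallP tight [mN ldl inv]; rewrite /= in mN ldl inv.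
set rho := slack (m, l) j in tight *.
have rho_ge0 : 0 <= rho by rewrite subr_ge0; case/andP: (ldl j).
have dl_ge0 i : 0 <= deadline m i.
  by rewrite divr_ge0 ?slope_ge0.
pose l1 i := if e \in sets i then l i + rho else l i.
(* At tightness the weighted load of [j] is its slope, the very bound on the growth of
   [N * potential]. *)
have l1j : (m j + q)%:R * l1 j = slope m j.
  rewrite /l1 ej /rho /slack /= addrCA subrr addr0 /deadline mulrCA divff ?mulr1//.
  by rewrite pnatr_eq0 -lt0n addn_gt0 q_gt0 orbT.
have l1_ge0 i : 0 <= l1 i.
  by rewrite /l1; case: ifP => _; [apply: addr_ge0|] => //; case/andP: (ldl i).
have l1dl i : l1 i <= deadline m i.
  rewrite /l1; case: ifP => [ei|_]; last by case/andP: (ldl i).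
  by have /implyP/(_ ei) := tight i; rewrite /slack /= lerBrDl.
split => /=.
- move=> i; rewrite /increment; have [->|_] := eqVneq i j; last by rewrite addn0.
  rewrite addn1; apply: leq_ltn_trans notfull.
  by rewrite (bigD1 j)//= leq_addr.
- move=> i; have [->|ij] := eqVneq i j.
    by rewrite lexx divr_ge0 ?slope_ge0.
  rewrite -/(l1 i) l1_ge0 /=; apply: le_trans (l1dl i) _.
  apply: deadline_le => [?|]; first exact: increment_grows.
  by rewrite /increment (negbTE ij) addn0.
- have raise : N%:R * potential m + \sum_i (m i + q)%:R * l1 i <=
      2 * N%:R * \sum_(i in J) (slope m i * shifted_harmonic (m i) + l1 i).
    have lhsE : \sum_i (m i + q)%:R * l1 i =
        \sum_i (m i + q)%:R * l i + (\sum_(i | e \in sets i) (m i + q)%:R) * rho.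
      rewrite mulr_suml [X in _ = _ + X]big_mkcond -big_split /=.
      by apply: eq_bigr => i _; rewrite /l1; case: ifP => _; rewrite ?addr0// mulrDr.
    (* The [m i] sum to less than [N] since [e] is unfilled, and at most [d] sets add [q] each,
       which is another [N]. *)
    have wle : \sum_(i | e \in sets i) (m i + q)%:R <= 2 * N%:R :> R.
      rewrite -natr_sum -[2]/(2%:R) -natrM ler_nat big_split /= mul2n -addnn.
      apply: leq_add; first exact: ltnW.
      rewrite sum_nat_const mulnC leq_mul2l; apply/orP; right.
      by apply: leq_trans (freq e); rewrite cardsE.
    have rhsE : \sum_(i in J) (slope m i * shifted_harmonic (m i) + l i) + rho <=
        \sum_(i in J) (slope m i * shifted_harmonic (m i) + l1 i).
      rewrite (bigD1 i0) // [leRHS](bigD1 i0) //=.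
      have : \sum_(i in J | i != i0) (slope m i * shifted_harmonic (m i) + l i) <=
          \sum_(i in J | i != i0) (slope m i * shifted_harmonic (m i) + l1 i).
        apply: ler_sum => i _; rewrite lerD2l /l1.
        by case: ifP => _; rewrite ?lerDl.
      rewrite {2}/l1 ei0; lra.
    have : (\sum_(i | e \in sets i) (m i + q)%:R) * rho <= 2 * N%:R * rho.
      by rewrite ler_wpM2r.
    have : 2 * N%:R * (\sum_(i in J) (slope m i * shifted_harmonic (m i) + l i) + rho) <=
       2 * N%:R * \sum_(i in J) (slope m i * shifted_harmonic (m i) + l1 i).
      by rewrite ler_wpM2l// mulr_ge0.
    rewrite lhsE mulrDr; lra.
  have lhs : N%:R * potential (increment m j) + \sum_i (increment m j i + q)%:R *
      (if i == j then 0 else l1 i) <=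
      N%:R * potential m + \sum_i (m i + q)%:R * l1 i.
    rewrite (bigD1 j)//= eqxx mulr0 add0r [X in _ <= _ + X](bigD1 j)//= l1j addrA.
    apply: lerD; first exact: potential_increment.
    rewrite le_eqVlt; apply/orP; left; apply/eqP; apply: eq_bigr => i /negbTE ij.
    by rewrite ij /increment ij addn0.
  apply: le_trans lhs _; apply: le_trans raise _.
  rewrite ler_wpM2l ?mulr_ge0//; apply: ler_sum => i _.
  (* The load of [j], now reset, reappears as the new last term of the harmonic sum. *)
  have [->|ij] := eqVneq i j.
    rewrite addr0 /increment eqxx addn1 /shifted_harmonic big_ord_recr /=.
    rewrite -/(shifted_harmonic (m j)).
    have -> : l1 j = slope m j * (m j + q)%:R^-1.
      by rewrite -l1j mulrAC divff ?mul1r// pnatr_eq0 -lt0n addn_gt0 q_gt0 orbT.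
    rewrite -mulrDr ler_wpM2r ?addr_ge0 ?shifted_harmonic_ge0 ?invr_ge0//.
    by apply: slope_le => ?; exact: increment_grows.
  rewrite /increment (negbTE ij) addn0 -/(increment m j) lerD2r.
  rewrite ler_wpM2r ?shifted_harmonic_ge0//.
  by apply: slope_le => ?; exact: increment_grows.
Qed.

Lemma invariant_run J s : covers J s -> invariant J (run s).
Proof.
elim/last_ind: s => [_|s e IH].
  split => /=.
  - by [].
  - by move=> j; rewrite lexx divr_ge0 ?slope_ge0.
  - rewrite [X in _ + X]big1 ?addr0 => [|j _]; last by rewrite mulr0.
    have load0 k : frac_load (fun=> 0%N) k = 0.
      by rewrite /frac_load big1// => j _; rewrite mul0r mulr0.
    have -> : potential (fun=> 0%N) = 0.
      rewrite /potential big1 => [|k _]; last by rewrite load0 powR0 ?gt_eqF.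
      by rewrite big1 ?addr0// => j _; rewrite mul0r mulr0.
    rewrite mulr0 mulr_ge0 ?mulr_ge0// sumr_ge0// => j _.
    by rewrite addr0 mulr_ge0 ?slope_ge0 ?shifted_harmonic_ge0.
rewrite /covers all_rcons => /andP[/existsP[i /andP[iJ ei]] cs].
rewrite run_rcons /arrive; elim: N => [|k IHk] /=; first exact: IH.
rewrite {1}/step; case: ifPn => // nf; case: pickP => // j tj.
by apply: invariant_raise_and_increment => //; exists i.
Qed.

Lemma arrive_filled st e : (exists i : 'I_n, e \in sets i) -> filled e (arrive st e).1.
Proof.
case=> i0 ei0.
suff h k : (minn k N <= \sum_(j | e \in sets j) (iter k (step e) st).1 j)%N.
  by have := h N; rewrite minnn.
elim: k => [|k IH]; first by rewrite min0n.
rewrite iterS {1}/step; case: ifPn => [f|nf].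
  by apply: leq_trans f; exact: geq_minr.
case: pickP => [j /andP[ej _]|none]; last first.
  (* Among the sets containing [e] one has least slack, so the choice cannot fail. *)
  case: (@Order.TotalTheory.arg_minP _ R _ i0 (fun i => e \in sets i)
    (slack (iter k (step e) st)) ei0) => i ei imin.
  have := none i; rewrite /tightest ei /= => /negbT /negP [].
  by apply/forallP => i'; apply/implyP => /imin.
rewrite /= /increment big_split /= [X in (_ + X)%N](bigD1 j)//= eqxx.
have h : (minn k.+1 N <= minn k N + 1)%N by move: N => N'; lia.
by apply: leq_trans h (leq_add IH _); rewrite leq_addr.
Qed.

End Fractional.

(** * Competitive ratio of the fractional cover *)

Section FractionalBound.
Variables (R : realType) (I : instance R) (q d : nat).
Local Notation p := (expo I).
Local Notation n := (nsets I).
Local Notation K := (ncosts I).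
Local Notation N := (q * d)%N.
Local Notation pot := (potential q d).
Local Notation H := (1 + ln (1 + d%:R) : R).
Hypotheses (q_gt0 : (0 < q)%N) (d_gt0 : (0 < d)%N) (p_le_q : p <= q%:R).
Hypothesis freq : forall e : ground I, (#|[set j | e \in sets j]%SET| <= d)%N.

Let N_gt0 : (0 < N)%N. Proof. by rewrite muln_gt0 q_gt0. Qed.
Let NR_gt0 : 0 < N%:R :> R. Proof. by rewrite ltr0n. Qed.
Let p1 : 1 <= p. Proof. exact: expo_ge1. Qed.
Let p_gt0 : 0 < p. Proof. exact: expo_gt0. Qed.

Lemma expR1_ge2 : 2 <= expR 1 :> R.
Proof. by rewrite (le_trans _ (expR_ge1Dx _)). Qed.

(** Removes the discrete shift [cost k j / N]: splitting the power with exponent [p - 1] multiplies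
    the shift by [p], and [p <= q <= N] brings it back below [cost k j]. *)
Lemma slope_le_marginal m (j : 'I_n) :
  slope q d m j <=
  expR 1 * p * (\sum_k cost k j * frac_load q d m k `^ (p - 1))
  + (p + 1) * power_price j.
Proof.
suff h : \sum_k cost k j * (frac_load q d m k + cost k j / N%:R) `^ (p - 1) <=
    expR 1 * (\sum_k cost k j * frac_load q d m k `^ (p - 1)) + power_price j.
  have := ler_wpM2l (ltW p_gt0) h; rewrite /slope; lra.
rewrite mulr_sumr -big_split /=; apply: ler_sum => k _.
have b0 := cost_ge0 k j; have u0 := frac_load_ge0 q d m k.
rewrite (powR_mulr_pred b0 p1) mulrCA -mulrDr ler_wpM2l//.
have q0 : 0 <= p - 1 by rewrite subr_ge0.
apply: le_trans (powRD_split u0 _ q0) _; first by rewrite divr_ge0.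
rewrite lerD2l; apply: ge0_leq_powR => //.
  by rewrite mulr_ge0 ?divr_ge0// addrC subrK ltW.
rewrite addrC subrK mulrCA ler_piMr// ler_pdivrMr// mul1r.
by rewrite (le_trans p_le_q)// ler_nat leq_pmulr.
Qed.

(** As [N = q * d], the ratio [(N + q) / q] is [1 + d]. The successor leaves room for the load not
    yet discharged. *)
Lemma shifted_harmonic_succ_le i : (i <= N)%N -> @shifted_harmonic R q i.+1 <= H.
Proof.
move=> iN; have q0 : q%:R != 0 :> R by rewrite pnatr_eq0 -lt0n.
have -> : 1 + d%:R = (N + q)%:R / q%:R :> R.
  by rewrite natrD natrM mulrDl mulrAC divff// mul1r addrC.
apply: le_trans (@harmonic_le_ln R q N q_gt0).
rewrite /shifted_harmonic -!(big_mkord xpredT (fun t => (t + q)%:R^-1)).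
rewrite [leRHS](big_cat_nat (n := i.+1))//=.
by rewrite lerDl sumr_ge0// => t _; rewrite invr_ge0.
Qed.

(** Weak duality: the loads on the left are dropped, and each load on the right is at most one
    further harmonic term times the slope. *)
Lemma potential_le_slopes (J : {set 'I_n}) s : covers J s ->
  pot (run q d s).1 <= 2 * H * \sum_(j in J) slope q d (run q d s).1 j.
Proof.
move=> /(invariant_run q_gt0 d_gt0 freq).
case: (run q d s) => m l [/= mN ldl inv].
have slack0 : 0 <= \sum_j (m j + q)%:R * l j.
  by apply: sumr_ge0 => j _; rewrite mulr_ge0//; case/andP: (ldl j).
have rhs : \sum_(j in J) (slope q d m j * @shifted_harmonic R q (m j) + l j) <=
    H * \sum_(j in J) slope q d m j.
  rewrite mulr_sumr; apply: ler_sum => j _.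
  apply: le_trans (_ : slope q d m j * @shifted_harmonic R q (m j).+1 <= _).
    rewrite /shifted_harmonic big_ord_recr /= mulrDr lerD2l.
    by case/andP: (ldl j).
  by rewrite mulrC ler_wpM2r ?slope_ge0// shifted_harmonic_succ_le.
rewrite -(ler_pM2l NR_gt0).
have := ler_wpM2l (mulr_ge0 (ler0n R 2) (ltW NR_gt0)) rhs.
lra.
Qed.

Lemma sum_power_price_le (J : {set 'I_n}) :
  \sum_(j in J) power_price j <= power_cost J.
Proof.
rewrite exchange_big /=; apply: ler_sum => k _.
apply: powR_sum_superadd => // j; exact: cost_ge0.
Qed.

(** The slopes involve the potential again: Young's inequality bounds their share by half the
    potential plus a multiple of [power_cost J], and the half is absorbed. *)
Lemma potential_le_power_cost (J : {set 'I_n}) s : covers J s ->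
  pot (run q d s).1 <= 3 * (4 * H * expR 1 * p) `^ p * power_cost J.
Proof.
move=> /potential_le_slopes; set m := (run q d s).1 => h.
have E2 := expR1_ge2.
have H1 : 1 <= H by rewrite lerDl ln_ge0// lerDl.
have H0 : 0 <= H := le_trans ler01 H1.
have HE1 : 1 <= 4 * H * expR 1 * p.
  by rewrite !mulr_ege1// ?ler1n// (le_trans _ E2)// ler1n.
set u := frac_load q d m.
have u0 k : 0 <= u k by exact: frac_load_ge0.
set v := cost_vector J.
have v0 k : 0 <= v k by exact: cost_vector_ge0.
have slopes : \sum_(j in J) slope q d m j <=
    expR 1 * p * (\sum_k v k * u k `^ (p - 1)) + (p + 1) * power_cost J.
  apply: le_trans (ler_sum _ (fun j _ => slope_le_marginal m j)) _.
  rewrite big_split /= -!mulr_sumr; apply: lerD; last first.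
    by rewrite ler_wpM2l ?sum_power_price_le// addr_ge0 ?ltW.
  rewrite exchange_big /=.
  by under eq_bigr do rewrite -mulr_suml.
set c := 2 * H * (expR 1 * p).
have c0 : 0 <= c by rewrite !mulr_ge0 ?expR_ge0 ?(ltW p_gt0).
have young : c * (\sum_k v k * u k `^ (p - 1)) <=
    2^-1 * \sum_k u k `^ p + (2 * c) `^ p * power_cost J.
  rewrite !mulr_sumr -big_split /=; apply: ler_sum => k _.
  rewrite mulrA; apply: le_trans (powR_young (u0 k) _ p1) _.
    by rewrite mulr_ge0.
  by rewrite lerD2l mulrA (powRM p (mulr_ge0 (ler0n R 2) c0) (v0 k)).
have cE : 2 * c = 4 * H * expR 1 * p by rewrite /c; ring.
rewrite cE in young.
have pot_ge : \sum_k u k `^ p <= pot m.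
  rewrite lerDl sumr_ge0// => j _.
  by rewrite mulr_ge0 ?divr_ge0 ?power_price_ge0.
have PC0 := power_cost_ge0 J.
have big : 4 * H * expR 1 * p <= (4 * H * expR 1 * p) `^ p.
  rewrite -[leLHS]powRr1 ?(le_trans _ HE1)//; exact: ler_powR.
have small : 4 * H * (p + 1) <= 4 * H * expR 1 * p.
  rewrite -[leRHS]mulrA ler_wpM2l ?mulr_ge0//.
  have E2p : 2 * p <= expR 1 * p by rewrite ler_wpM2r ?(ltW p_gt0).
  have p1' : 1 <= p := p1; lra.
have f1 : 2 * H * \sum_(j in J) slope q d m j <=
    c * (\sum_k v k * u k `^ (p - 1)) + 2 * H * (p + 1) * power_cost J.
  have H20 : 0 <= 2 * H by rewrite mulr_ge0.
  apply: le_trans (ler_wpM2l H20 slopes) _.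
  by rewrite mulrDr !mulrA /c !mulrA.
have f2 : 4 * H * (p + 1) * power_cost J <=
    (4 * H * expR 1 * p) `^ p * power_cost J.
  exact: ler_wpM2r PC0 _ _ (le_trans small big).
(* Absorbing the half doubles the rest: two copies of the power come from [young] and one from [f2],
   hence the 3. *)
lra.
Qed.

End FractionalBound.

(** * Independent uniform thresholds *)

Section UniformThresholds.
Variables (R : realType) (n M : nat).
Local Notation Omega := {ffun 'I_n -> 'I_M}.
Implicit Types (w : Omega) (X : Omega -> R).

Definition avg X : R := (\sum_w X w) / #|[set: Omega]|%:R.

Definition resample w (j : 'I_n) (t : 'I_M) : Omega :=
  [ffun i => if i == j then t else w i].

(** Exchanging [t] with the threshold of [j] is an involution on pairs, after which the summand no
    longer depends on [t]. *)
Lemma sum_resample X j :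
  \sum_w \sum_(t < M) X (resample w j t) = M%:R * \sum_w X w.
Proof.
rewrite pair_big /=.
pose h (c : Omega * 'I_M) := (resample c.1 j c.2, c.1 j).
have hK : involutive h.
  case=> w t; rewrite /h /=; congr (_, _); last by rewrite ffunE eqxx.
  by apply/ffunP => i; rewrite !ffunE; case: eqVneq => [->|].
rewrite (reindex_inj (inv_inj hK)) /=.
under eq_bigr => c _.
  have -> : resample (resample c.1 j c.2) j (c.1 j) = c.1.
    by apply/ffunP => i; rewrite !ffunE; case: eqVneq => [->|].
  over.
rewrite -(pair_big xpredT xpredT (fun w (_ : 'I_M) => X w)) /=.
under eq_bigr do rewrite sumr_const card_ord -mulr_natl.
by rewrite -mulr_sumr.
Qed.

Hypothesis M_gt0 : (0 < M)%N.
Let MR_gt0 : 0 < M%:R :> R. Proof. by rewrite ltr0n. Qed.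

Lemma card_thresholds_gt0 : 0 < #|[set: Omega]|%:R :> R.
Proof. by rewrite ltr0n cardsT card_ffun !card_ord expn_gt0 M_gt0. Qed.

Lemma avg_le X Y : (forall w, X w <= Y w) -> avg X <= avg Y.
Proof.
by move=> XY; rewrite ler_pM2r ?invr_gt0 ?card_thresholds_gt0// ler_sum.
Qed.

Lemma eq_avg X Y : X =1 Y -> avg X = avg Y.
Proof. by move=> XY; rewrite /avg (eq_bigr _ (fun w _ => XY w)). Qed.

Lemma avg_cst (c : R) : avg (fun=> c) = c.
Proof.
have := card_thresholds_gt0; rewrite /avg sumr_const cardsT => c0.
by rewrite -[c *+ _]mulr_natr mulfK// gt_eqF.
Qed.

Lemma avgD X Y : avg (fun w => X w + Y w) = avg X + avg Y.
Proof. by rewrite /avg big_split mulrDl. Qed.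

Lemma avgZ (c : R) X : avg (fun w => c * X w) = c * avg X.
Proof. by rewrite /avg -mulr_sumr mulrA. Qed.

Lemma avg_sum (T : finType) (P : pred T) (X : T -> Omega -> R) :
  avg (fun w => \sum_(i | P i) X i w) = \sum_(i | P i) avg (X i).
Proof. by rewrite /avg exchange_big -mulr_suml. Qed.

Variable a : 'I_n -> nat.

Definition hit w (j : 'I_n) : bool := (w j < a j)%N.

Lemma count_below (b : nat) : (\sum_(t < M) (t < b) = minn M b)%N.
Proof.
elim: M => [|k IH]; first by rewrite big_ord0 min0n.
by rewrite big_ord_recr /= IH; case: ltnP; lia.
Qed.

Lemma count_hit (b : nat) : \sum_(t < M) (t < b)%N%:R <= b%:R :> R.
Proof. by rewrite -natr_sum ler_nat count_below geq_minr. Qed.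

(** Redrawing threshold [j] preserves the average; for fixed [w] the fresh value hits in at most
    [a j] of [M] cases, while [X] stays below [Y w]. This is how independence enters. *)
Lemma avg_hit_mul (X Y : Omega -> R) j :
  (forall w t, X (resample w j t) <= Y w) -> (forall w, 0 <= Y w) ->
  avg (fun w => (hit w j)%:R * X w) <= (a j)%:R / M%:R * avg Y.
Proof.
move=> XY Y0; rewrite /avg mulrA ler_pM2r ?invr_gt0 ?card_thresholds_gt0//.
rewrite mulrAC ler_pdivlMr// mulrC -(sum_resample _ j) mulr_sumr.
apply: ler_sum => w _.
apply: le_trans (_ : \sum_(t < M) ((t < a j)%N%:R * Y w) <= _).
  apply: ler_sum => t _; rewrite /hit ffunE eqxx.
  by rewrite ler_wpM2l.
by rewrite -mulr_suml ler_wpM2r ?count_hit.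
Qed.

(** Redrawing threshold [j] raises the sum by at most [b j], so [powRD_split] separates the power
    [p - 1] of the sum from that of [p * b j]. Young's inequality then absorbs half of the moment,
    whence the factors 2. *)
Lemma moment_bound (b : 'I_n -> R) (p : R) : 1 <= p -> (forall j, 0 <= b j) ->
  avg (fun w => (\sum_j b j * (hit w j)%:R) `^ p) <=
  2 * (2 * (expR 1 * \sum_j b j * ((a j)%:R / M%:R))) `^ p +
  2 * p `^ p * \sum_j b j `^ p * ((a j)%:R / M%:R).
Proof.
move=> p1 b0; set mu := \sum_j b j * _; set S := \sum_j b j `^ p * _.
pose Z w := \sum_j b j * (hit w j)%:R.
have p0 : 0 <= p by exact: le_trans p1.
have q0 : 0 <= p - 1 by rewrite subr_ge0.
have Z0 w : 0 <= Z w by apply: sumr_ge0 => j _; rewrite mulr_ge0.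
have mu0 : 0 <= mu by apply: sumr_ge0 => j _; rewrite mulr_ge0 ?divr_ge0.
have ZE w : Z w `^ p = \sum_j b j * ((hit w j)%:R * Z w `^ (p - 1)).
  by rewrite (powR_mulr_pred (Z0 w) p1) mulr_suml; under eq_bigr do rewrite -mulrA.
have Zres w j t : Z (resample w j t) <= Z w + b j.
  rewrite /Z (bigD1 j)//= [X in _ <= X + _](bigD1 j)//= addrC.
  have -> : \sum_(i < n | i != j) b i * (hit (resample w j t) i)%:R =
            \sum_(i < n | i != j) b i * (hit w i)%:R.
    by apply: eq_bigr => i /negbTE ij; rewrite /hit ffunE ij.
  have h1 : b j * (hit (resample w j t) j)%:R <= b j.
    by rewrite ler_piMr// lern1 leq_b1.
  have h2 : 0 <= b j * (hit w j)%:R by rewrite mulr_ge0.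
  lra.
have term j : b j * avg (fun w => (hit w j)%:R * Z w `^ (p - 1)) <=
    b j * ((a j)%:R / M%:R) * (expR 1 * avg (fun w => Z w `^ (p - 1)))
    + p `^ p * (b j `^ p * ((a j)%:R / M%:R)).
  apply: le_trans (_ : b j * ((a j)%:R / M%:R * avg
      (fun w => expR 1 * Z w `^ (p - 1) + (p * b j) `^ (p - 1))) <= _).
    rewrite ler_wpM2l//; apply: avg_hit_mul => [w t|w]; last first.
      by rewrite addr_ge0 ?mulr_ge0 ?expR_ge0 ?powR_ge0.
    have := powRD_split (Z0 w) (b0 j) q0; rewrite [1 + _]addrC subrK.
    apply: le_trans; exact: ge0_leq_powR.
  rewrite avgD avgZ avg_cst [leLHS]mulrA mulrDr lerD2l.
  rewrite (powR_mulr_pred (b0 j) p1) powRM//.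
  rewrite [leLHS](_ : _ = p `^ (p - 1) *
    (b j * b j `^ (p - 1) * ((a j)%:R / M%:R))); last by ring.
  rewrite ler_wpM2r ?mulr_ge0 ?powR_ge0 ?divr_ge0//.
  by apply: ler_powR => //; lra.
have main : avg (fun w => Z w `^ p) <=
    expR 1 * mu * avg (fun w => Z w `^ (p - 1)) + p `^ p * S.
  rewrite (_ : avg _ = \sum_j b j * avg (fun w => (hit w j)%:R * Z w `^ (p - 1))).
    apply: le_trans (ler_sum _ (fun j _ => term j)) _.
    rewrite big_split /= -mulr_suml -mulr_sumr lerD2r mulrCA mulrA//.
  under [RHS]eq_bigr do rewrite -avgZ.
  by rewrite -avg_sum; congr avg; apply/funext => w; exact: ZE.
have young : expR 1 * mu * avg (fun w => Z w `^ (p - 1)) <=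
    2^-1 * avg (fun w => Z w `^ p) + (2 * (expR 1 * mu)) `^ p.
  rewrite -avgZ -avgZ -[X in _ <= _ + X]avg_cst -avgD; apply: avg_le => w.
  by apply: powR_young => //; rewrite mulr_ge0 ?expR_ge0.
rewrite -/(Z _); lra.
Qed.

(** By independence the average is a product of survival probabilities, each bounded through
    [1 - x <= expR (- x)]. *)
Lemma avg_miss (A : pred 'I_n) :
  avg (fun w => [forall (j | A j), ~~ hit w j]%:R) <=
  expR (- ((\sum_(j | A j) a j)%:R / M%:R)).
Proof.
pose F (j : 'I_n) (t : 'I_M) : R := (A j ==> (a j <= t)%N)%:R.
have FE w : [forall (j | A j), ~~ hit w j]%:R = \prod_j F j (w j).
  rewrite /F; case: forallP => [h|/forallP].
    by rewrite big1// => j _; have := h j; rewrite /hit -leqNgt => ->.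
  rewrite negb_forall => /existsP[j]; rewrite /hit -leqNgt => /negbTE hj.
  by rewrite (bigD1 j)//= hj mul0r.
have cardE : #|[set: Omega]|%:R = \prod_(j < n) M%:R :> R.
  by rewrite cardsT card_ffun !card_ord natrX prodr_const card_ord.
rewrite /avg (eq_bigr _ (fun w _ => FE w)) -(bigA_distr_bigA F) cardE.
rewrite -prodf_div natr_sum mulr_suml -sumrN expR_sum [leRHS]big_mkcond /=.
apply: ler_prod => j _; rewrite divr_ge0 ?sumr_ge0//= /F ler_pdivrMr//.
case: (A j) => /=; last by rewrite sumr_const card_ord mul1r.
have -> : \sum_(t < M) (a j <= t)%N%:R = (M - minn M (a j))%:R :> R.
  rewrite -natr_sum -(count_below (a j)); congr _%:R.
  rewrite -[X in (X - _)%N](card_ord M) -sum1_card.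
  have -> : (\sum_(t < M) 1 = \sum_(t < M) (a j <= t) + \sum_(t < M) (t < a j))%N.
    by rewrite -big_split; apply: eq_bigr => t _; rewrite /=; case: leqP.
  by rewrite addnK.
(* If [a j >= M], the threshold is always hit and its factor is 0. *)
have [Ma|aM] := leqP M (a j); first by rewrite subnn mulr_ge0 ?expR_ge0.
rewrite natrB ?(ltnW aM)//.
have -> : M%:R - (a j)%:R = (1 + - ((a j)%:R / M%:R)) * M%:R :> R.
  by rewrite mulrDl mul1r mulNr divfK// gt_eqF.
by rewrite ler_pM2r// expR_ge1Dx.
Qed.

End UniformThresholds.

(** * The randomized algorithm *)

Section UniformOnNat.
Variables (R : realType) (N : nat).

Lemma uniform_weight_ge0 : 0 <= (N.+1%:R)^-1 :> R.
Proof. by rewrite invr_ge0. Qed.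

Definition uniform_nat : set nat -> \bar R :=
  msum (fun k => mscale (NngNum uniform_weight_ge0) \d_k) N.+1.

HB.instance Definition _ := Measure.on uniform_nat.

Let uniform_nat_setT : uniform_nat setT = 1%E.
Proof.
rewrite /uniform_nat /msum /= /mscale /=.
under eq_bigr do rewrite diracT mule1.
by rewrite sumEFin sumr_const card_ord -(mulr_natr N.+1%:R^-1) mulVf.
Qed.

HB.instance Definition _ :=
  @Measure_isProbability.Build _ _ R uniform_nat uniform_nat_setT.

Lemma integral_uniform_nat (f : nat -> R) : (forall k, 0 <= f k) ->
  (\int[uniform_nat]_k (f k)%:E)%E = ((\sum_(k < N.+1) f k) / N.+1%:R)%:E.
Proof.
move=> f0; rewrite ge0_integral_measure_sum//=; last first.
  by move=> k _; rewrite lee_fin.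
rewrite mulrC mulr_sumr -sumEFin; apply: eq_bigr => k _.
rewrite ge0_integral_mscale//=; last by move=> x _; rewrite lee_fin.
by rewrite integral_dirac//= diracT mul1e.
Qed.

End UniformOnNat.

(** * Threshold rounding with emergency purchases *)

Section Algorithm.
Variables (R : realType) (I : instance R).
Local Notation p := (expo I).
Local Notation n := (nsets I).
Implicit Types (s : seq (ground I)) (e : ground I) (J : {set 'I_n}).

Definition granularity : nat := (Num.truncn p).+1.
(** The maximum with 1 keeps the grid nonempty when no element lies in any set. *)
Definition frequency : nat := maxn 1 (max_frequency I).
(** The rounding factor lambda: an integer above [ln (1 + r)], so that boosted values stay on the
    grid. *)
Definition boost : nat := (Num.truncn (ln (1 + #|ground I|%:R : R))).+1.

Local Notation q := granularity.
Local Notation d := frequency.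
Local Notation M := (q * d)%N.
Local Notation Omega := {ffun 'I_n -> 'I_M}.

Lemma frequency_gt0 : (0 < d)%N. Proof. by rewrite leq_maxl. Qed.

Lemma grid_gt0 : (0 < M)%N. Proof. by rewrite muln_gt0 frequency_gt0. Qed.

Definition boosted s (j : 'I_n) : nat := (boost * (run q d s).1 j)%N.

Definition rounded (w : Omega) s : {set 'I_n} := [set j | hit (boosted s) w j]%SET.

Definition missed (w : Omega) s e : bool := ~~ covers (rounded w s) [:: e].

Definition fallback (e : ground I) : {set 'I_n} :=
  [arg min_(J < [set: 'I_n]%SET | covers J [:: e]) objective J]%O.

(* [index] is the first occurrence, so [take] stops right after the first
   arrival of [e] and later repetitions do not matter. *)
Definition emergency (w : Omega) s (e : ground I) : bool :=
  (e \in s) && missed w (take (index e s).+1 s) e.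

Definition chosen (w : Omega) s : {set 'I_n} :=
  (rounded w s :|: \bigcup_(e | emergency w s e) fallback e)%SET.

Lemma coversE J s : covers J s = all (fun e => covers J [:: e]) s.
Proof. by apply: eq_all => e; rewrite /covers /= andbT. Qed.

Lemma covers_sub J J' s : J \subset J' -> covers J s -> covers J' s.
Proof.
move=> /fintype.subsetP JJ'; apply: sub_all => e /existsP[j /andP[jJ ej]].
by apply/existsP; exists j; rewrite JJ'.
Qed.

Lemma coverable_mem s e : coverable s -> e \in s -> coverable [:: e].
Proof. by rewrite /coverable coversE => /allP; apply. Qed.

Lemma fallback_covers e : coverable [:: e] -> covers (fallback e) [:: e].
Proof.
rewrite /coverable => ce; pose P (J : {set 'I_n}) := covers J [:: e].
have := @Order.TotalTheory.arg_minP _ _ _ _ P (@objective R I) ce.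
rewrite /fallback; set J0 := Order.arg_min _ _ _.
by case.
Qed.

(** An optimal cover of [s] covers [e] in particular, hence competes with the fallback. *)
Lemma objective_fallback s e : coverable s -> e \in s ->
  objective (fallback e) <= opt s.
Proof.
move=> cs es; have ce := coverable_mem cs es.
have [J [cJ <-] _] := optP cs; have [_ _ h] := optP ce; apply: h.
by move: cJ; rewrite coversE => /allP; apply.
Qed.

Lemma rounded_rcons w s e : rounded w s \subset rounded w (rcons s e).
Proof.
apply/fintype.subsetP => j; rewrite !inE /hit => /leq_trans; apply.
by rewrite /boosted leq_mul2l run_rcons arrive_grows orbT.
Qed.

Lemma rounded_take w s i : rounded w (take i s) \subset rounded w s.
Proof.
apply/fintype.subsetP => j; rewrite !inE /hit => /leq_trans; apply.
by rewrite /boosted leq_mul2l run_take_grows orbT.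
Qed.

Lemma chosen_irrevocable w s e : chosen w s \subset chosen w (rcons s e).
Proof.
apply: finset.setUSS; first exact: rounded_rcons.
apply/finset.bigcupsP => e' em; apply: (finset.bigcup_sup e').
move: em; rewrite /emergency => /andP[es ms].
(* Appending an element moves no first occurrence inside [s], so past emergencies persist. *)
rewrite mem_rcons inE es orbT /= -cats1 index_cat es takel_cat//.
by rewrite index_mem.
Qed.

Lemma chosen_covers w s : coverable s -> covers (chosen w s) s.
Proof.
move=> cs; rewrite coversE; apply/allP => e es.
have [ms|] := boolP (missed w (take (index e s).+1 s) e).
  apply: covers_sub (fallback_covers (coverable_mem cs es)).
  apply: fintype.subset_trans (finset.subsetUr _ _).
  by apply: (finset.bigcup_sup e); rewrite /emergency es.
rewrite negbK; apply: covers_sub.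
by apply: fintype.subset_trans (finset.subsetUl _ _); exact: rounded_take.
Qed.

(* Thresholds are coded by natural numbers to reuse the discrete sigma-algebra
   of [nat]; codes beyond the enumeration have probability 0. *)
Definition decode (k : nat) : Omega :=
  nth [ffun=> Ordinal grid_gt0] (enum {: Omega}) k.

(** The bound [.-1.+1] matches [uniform_nat], whose support has one point more than its
    parameter. *)
Lemma sum_decode (f : Omega -> R) :
  \sum_(k < #|{: Omega}|.-1.+1) f (decode k) = \sum_w f w.
Proof.
have O_gt0 : (0 < #|{: Omega}|)%N.
  by apply/card_gt0P; exists [ffun=> Ordinal grid_gt0].
rewrite prednK// -(big_mkord xpredT (fun k => f (decode k))) cardE.
by rewrite -(big_nth _ xpredT f) big_enum.
Qed.

Definition threshold_algorithm : online_algorithm I :=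
  @OnlineAlgorithm R I _ nat (uniform_nat R #|{: Omega}|.-1)
    (fun k s => chosen (decode k) s)
    (* Every subset of [nat] is measurable. *)
    (fun _ _ => Logic.I)
    (fun k s e => chosen_irrevocable (decode k) s e)
    (fun k s cs => chosen_covers (decode k) cs).

Lemma expectation_chosen s :
  ('E_(law threshold_algorithm)[fun w =>
      objective (select threshold_algorithm w s)])%E =
  (avg (fun w => objective (chosen w s)))%:E.
Proof.
have O_gt0 : (0 < #|{: Omega}|)%N.
  by apply/card_gt0P; exists [ffun=> Ordinal grid_gt0].
rewrite unlock /= integral_uniform_nat; last by move=> k; exact: lp_norm_ge0.
by rewrite (sum_decode (fun w => objective (chosen w s))) /avg cardsT prednK.
Qed.

End Algorithm.

(** * Competitive analysis *)

Section Analysis.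
Variables (R : realType) (I : instance R).
Local Notation p := (expo I).
Local Notation n := (nsets I).
Local Notation q := (granularity I).
Local Notation d := (frequency I).
Local Notation M := (q * d)%N.
Local Notation H := (1 + ln (1 + d%:R) : R).
Local Notation Omega := {ffun 'I_n -> 'I_M}.
Implicit Types (s : seq (ground I)) (e : ground I) (w : Omega) (J : {set 'I_n}).

Let p1 : 1 <= p. Proof. exact: expo_ge1. Qed.
Let p_gt0 : 0 < p. Proof. exact: expo_gt0. Qed.
Let q_gt0 : (0 < q)%N. Proof. by []. Qed.
Let M_pos : (0 < M)%N. Proof. exact: grid_gt0. Qed.
Let MR_gt0 : 0 < M%:R :> R. Proof. by rewrite ltr0n. Qed.

Lemma expo_le_granularity : p <= q%:R.
Proof. by rewrite ltW// truncnS_gt. Qed.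

Lemma frequencyP e : (#|[set j | e \in sets j]%SET| <= d)%N.
Proof.
rewrite leq_max; apply/orP; right.
exact: (leq_bigmax (F := fun e => #|[set j | e \in sets j]%SET|)).
Qed.

(** Right after its arrival [e] is filled, so the exponent in [avg_miss] is at least [boost], which
    exceeds [ln (1 + r)]. *)
Lemma avg_missed s e : coverable [:: e] -> e \in s ->
  avg (fun w : Omega => (missed w (take (index e s).+1 s) e)%:R) <=
  (1 + #|ground I|%:R)^-1 :> R.
Proof.
move=> ce es; set s' := take _ s.
have s'E : s' = rcons (take (index e s) s) e.
  by rewrite /s' (take_nth e) ?index_mem// nth_index.
have fill : filled q d e (run q d s').1.
  rewrite s'E run_rcons; apply: arrive_filled; first exact: q_gt0.
    exact: frequency_gt0.
  move: ce; rewrite /coverable /covers /= andbT => /existsP[j /andP[_ ej]].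
  by exists j.
have missE w : missed w s' e =
    [forall (j | e \in sets j), ~~ hit (boosted s') w j].
  rewrite /missed /covers /= andbT negb_exists; apply: eq_forallb => j.
  by rewrite inE negb_and implybE orbC.
under eq_fun do rewrite missE.
apply: le_trans (avg_miss _ M_pos _ _) _.
have r0 : 0 < 1 + #|ground I|%:R :> R by rewrite ltr_pwDl.
rewrite expRN lef_pV2 ?posrE ?expR_gt0// -[leLHS]lnK ?posrE// ler_expR.
apply: le_trans (_ : (boost I)%:R <= _); first by rewrite ltW// truncnS_gt.
rewrite ler_pdivlMr// -natrM ler_nat /boosted -big_distrr /=.
by rewrite leq_mul2l; apply/orP; right; exact: fill.
Qed.

(** [moment_bound] is applied to each cost. Its last terms, summed over [k], form the linear part of
    the potential. *)
Lemma avg_power_cost_rounded s :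
  avg (fun w : Omega => power_cost (rounded w s)) <=
  2 * (2 * expR 1 * p * (boost I)%:R) `^ p * potential q d (run q d s).1.
Proof.
set m := (run q d s).1; set X := 2 * expR 1 * p * _.
have E2 := expR1_ge2 R.
have l1 : 1 <= (boost I)%:R :> R by rewrite ler1n.
set lam := (boost I)%:R in X l1 *.
have l0 : 0 <= lam by exact: le_trans l1.
have X1 : 2 * (expR 1 * lam) <= X.
  rewrite /X -[leRHS]mulrA mulrA ler_wpM2l ?mulr_ge0 ?expR_ge0//.
  by rewrite ler_peMl.
(* Since [lam >= 1], the single factor [lam] is at most its power [p]. *)
have X2 : p `^ p * lam <= X `^ p.
  apply: le_trans (_ : p `^ p * lam `^ p <= _).
    rewrite ler_wpM2l ?powR_ge0// -[leLHS]powRr1//; exact: ler_powR.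
  rewrite -powRM// ?(ltW p_gt0)//; apply: ge0_leq_powR; rewrite ?(ltW p_gt0)//.
    by rewrite mulr_ge0 ?(ltW p_gt0).
  rewrite /X -[leRHS]mulrA ler_peMl ?mulr_ge0 ?(ltW p_gt0)//.
  by rewrite mulr_ege1 ?ler1n// (le_trans _ E2) ?ler1n.
rewrite /power_cost avg_sum.
have term k : avg (fun w : Omega => cost_vector (rounded w s) k `^ p) <=
    2 * X `^ p * (frac_load q d m k `^ p +
                  \sum_j cost k j `^ p * ((m j)%:R / M%:R)).
  have cvE w : cost_vector (rounded w s) k =
      \sum_j cost k j * (hit (boosted s) w j)%:R.
    rewrite /cost_vector big_mkcond; apply: eq_bigr => j _ /=.
    by rewrite inE; case: ifP; rewrite ?mulr1 ?mulr0.
  under eq_fun do rewrite cvE.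
  apply: le_trans (moment_bound M_pos (boosted s) p1 (cost_ge0 k)) _.
  have muE (f : 'I_n -> R) : \sum_j f j * ((boosted s j)%:R / M%:R) =
      lam * \sum_j f j * ((m j)%:R / M%:R).
    rewrite mulr_sumr; apply: eq_bigr => j _.
    by rewrite /boosted natrM -/m -/lam !mulrA (mulrC lam).
  rewrite !muE -/(frac_load q d m k) mulrDr; apply: lerD.
    rewrite -[leRHS]mulrA ler_wpM2l// -powRM ?frac_load_ge0//; last first.
      by rewrite (le_trans _ X1)// !mulr_ge0 ?expR_ge0.
    have fl0 := frac_load_ge0 q d m k.
    apply: ge0_leq_powR; rewrite ?(ltW p_gt0) ?mulr_ge0 ?expR_ge0//.
    by rewrite !mulrA; rewrite -!mulrA; rewrite !mulrA ler_wpM2r// -mulrA.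
  rewrite mulrA -(mulrA 2) ler_wpM2r//; last by rewrite ler_wpM2l.
  by apply: sumr_ge0 => j _; rewrite mulr_ge0 ?powR_ge0 ?divr_ge0.
apply: le_trans (ler_sum _ (fun k _ => term k)) _.
rewrite -mulr_sumr ler_wpM2l ?mulr_ge0 ?powR_ge0//.
rewrite big_split lerD2l /= exchange_big /=.
by apply: ler_sum => j _; rewrite -mulr_suml.
Qed.

(** The root is linearised at scale [A], so that a bound on the average of [power_cost] yields one
    on the average objective. *)
Lemma objective_linearization J (A : R) : 0 < A ->
  objective J <= A * (1 + power_cost J / A `^ p).
Proof.
move=> A0; have Ap0 : 0 < A `^ p by rewrite powR_gt0.
have PC0 := power_cost_ge0 J.
have r0 : 0 <= power_cost J / A `^ p by rewrite divr_ge0// ltW.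
rewrite objectiveE.
have -> : power_cost J `^ p^-1 = A * (power_cost J / A `^ p) `^ p^-1.
  rewrite -{1}(powR_inv_powR (ltW A0) p1) -powRM ?powR_ge0//.
  by rewrite mulrCA divff ?mulr1// gt_eqF.
by rewrite ler_wpM2l ?(ltW A0)// powR_inv_le1D.
Qed.

Lemma avg_objective_rounded s : coverable s ->
  avg (fun w : Omega => objective (rounded w s)) <=
  7 * (8 * expR 1 ^+ 2 * p ^+ 2 * (boost I)%:R * H) * opt s.
Proof.
move=> cs; set B := 8 * _ * _ * _ * _.
have H1 : 1 <= H by rewrite lerDl ln_ge0// lerDl.
have H0 : 0 <= H := le_trans ler01 H1.
have o0 : 0 <= opt s by exact: lp_norm_ge0.
have B0 : 0 <= B by rewrite /B !mulr_ge0 ?exprn_ge0 ?expR_ge0 ?(ltW p_gt0).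
(* [A] replaces [B * opt s], which may be 0 and could not be divided by. The 7 is [1 + 6], with 6
   the product of the factors 2 of rounding and 3 of the fractional bound. *)
suff key A : 0 < A -> B * opt s <= A ->
    avg (fun w : Omega => objective (rounded w s)) <= 7 * A.
  apply/ler_addgt0Pr => eps eps0.
  have : 0 < B * opt s + eps / 7 by rewrite ltr_wpDl ?divr_gt0// mulr_ge0.
  move=> /key; rewrite lerDl => /(_ (ltW (divr_gt0 eps0 (ltr0Sn _ _)))).
  move/le_trans; apply; rewrite mulrDr mulrA lerD2l mulrCA divff ?mulr1//.
move=> A0 BA; have Ap0 : 0 < A `^ p by rewrite powR_gt0.
have PC : avg (fun w : Omega => power_cost (rounded w s)) <= 6 * A `^ p.
  apply: le_trans (avg_power_cost_rounded s) _.
  have [J [cJ oJ] _] := optP cs.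
  have := potential_le_power_cost q_gt0 (frequency_gt0 I) expo_le_granularity frequencyP cJ.
  rewrite -objective_powR oJ.
  set X := 2 * expR 1 * p * _; set Y := 4 * _ * _ * _ => pot.
  have X0 : 0 <= X by rewrite !mulr_ge0 ?expR_ge0 ?(ltW p_gt0).
  have Y0 : 0 <= Y by rewrite !mulr_ge0 ?expR_ge0 ?(ltW p_gt0).
  apply: le_trans (_ : 2 * X `^ p * (3 * Y `^ p * opt s `^ p) <= _).
    by rewrite ler_wpM2l ?mulr_ge0 ?powR_ge0.
  have -> : 2 * X `^ p * (3 * Y `^ p * opt s `^ p) = 6 * (X * Y * opt s) `^ p.
    rewrite (powRM p (mulr_ge0 X0 Y0) o0) (powRM p X0 Y0).
    by move: (X `^ p) (Y `^ p) (opt s `^ p) => x y z; ring.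
  have XYE : X * Y = B by rewrite /X /Y /B; ring.
  rewrite XYE; apply: ler_wpM2l; first by [].
  by apply: ge0_leq_powR BA; [exact: ltW p_gt0|exact: mulr_ge0].
apply: le_trans (avg_le M_pos (fun w => objective_linearization (rounded w s) A0)) _.
rewrite avgZ avgD avg_cst//.
under [X in _ * (_ + X)]eq_avg do rewrite mulrC.
rewrite avgZ mulrC ler_pM2r//.
have : (A `^ p)^-1 * avg (fun w : Omega => power_cost (rounded w s)) <= 6.
  by rewrite mulrC ler_pdivrMr.
lra.
Qed.

(** At most [r] distinct elements arrive, each missed with probability at most [1 / (1 + r)] and
    repaired at cost at most [opt s]. This adds one [opt s], turning 7 into 8. *)
Lemma avg_objective_chosen s : coverable s ->
  avg (fun w : Omega => objective (chosen w s)) <=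
  8 * (8 * expR 1 ^+ 2 * p ^+ 2 * (boost I)%:R * H) * opt s.
Proof.
move=> cs; have o0 : 0 <= opt s by exact: lp_norm_ge0.
have r0 : 0 < 1 + #|ground I|%:R :> R by rewrite ltr_pwDl.
apply: le_trans (_ : avg (fun w : Omega => objective (rounded w s) +
    \sum_(e in s) (missed w (take (index e s).+1 s) e)%:R * opt s) <= _).
  apply: avg_le => // w; apply: le_trans (objectiveU _ _) _.
  rewrite lerD2l; apply: le_trans (objective_bigcup _ _) _.
  rewrite big_mkcondr /=; apply: ler_sum => e es.
  have := objective_fallback cs es; case: (missed w _ e) => h.
    by rewrite mul1r.
  by rewrite mul0r.
rewrite avgD avg_sum.
have miss : \sum_(e in s) avg (fun w : Omega =>
    (missed w (take (index e s).+1 s) e)%:R * opt s) <= opt s.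
  apply: le_trans (_ : \sum_(e in s) opt s * (1 + #|ground I|%:R)^-1 <= _).
    apply: ler_sum => e es.
    under [X in X <= _]eq_avg do rewrite mulrC.
    rewrite avgZ ler_wpM2l// avg_missed//.
    exact: coverable_mem es.
  rewrite -mulr_sumr -[leRHS]mulr1 ler_wpM2l// sumr_const.
  rewrite -(mulr_natl (1 + #|ground I|%:R)^-1).
  rewrite ler_pdivrMr// mul1r ler_wpDl// ler_nat; exact: max_card.
have := avg_objective_rounded cs; set B := 8 * _ * _ * _ * _ => rnd.
have B1 : 1 <= B.
  have H1 : 1 <= H by rewrite lerDl ln_ge0// lerDl.
  have E1 : 1 <= expR 1 :> R by rewrite (le_trans _ (expR1_ge2 R)) ?ler1n.
  have p2 : 1 <= p ^+ 2 by rewrite exprn_ege1.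
  have E2 : 1 <= expR 1 ^+ 2 :> R by rewrite exprn_ege1.
  have l1 : 1 <= (boost I)%:R :> R by rewrite ler1n.
  have e1 : 1 <= 8 :> R by rewrite ler1n.
  exact: mulr_ege1 (mulr_ege1 (mulr_ege1 (mulr_ege1 e1 E2) p2) l1) H1.
have : opt s <= B * opt s := ler_peMl o0 B1.
lra.
Qed.

Lemma chosen_nil (w : Omega) : chosen w [::] = finset.set0.
Proof.
apply/setP => j; rewrite !inE /hit /boosted /run /= muln0 ltn0 /=.
by rewrite big_pred0 ?inE.
Qed.

(** With at least one element the logarithm is at least 1/2, so rounding it up costs at most a
    factor 3. *)
Lemma boost_le : (0 < #|ground I|)%N ->
  (boost I)%:R <= 3 * ln (1 + #|ground I|%:R) :> R.
Proof.
move=> r0; have := ln1Dn_ge_half R r0; set L := ln _ => L2.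
have L0 : 0 <= L by lra.
have : (Num.truncn L)%:R <= L by rewrite truncn_le.
rewrite /boost -/L -natr1; lra.
Qed.

(** The constant is [576 = 64 * 3 * 3], the factors 3 turning [boost] and [1 + ln (1 + d)] into
    logarithms. *)
Lemma competitive_chosen s : coverable s ->
  avg (fun w : Omega => objective (chosen w s)) <=
  576 * expR 1 ^+ 2 * ratio_bound I * opt s.
Proof.
move=> cs; have o0 : 0 <= opt s by exact: lp_norm_ge0.
have ln0 (k : nat) : 0 <= ln (1 + k%:R) :> R by rewrite ln_ge0// lerDl.
have lnp : 0 < ln (1 + p) by rewrite ln_gt0// ltrDl.
have rb0 : 0 <= ratio_bound I.
  by rewrite /ratio_bound !mulr_ge0 ?invr_ge0 ?exprn_ge0 ?ln0 ?(ltW lnp) ?(ltW p_gt0).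
(* Without arrivals [r] or the maximum frequency may be 0 and the ratio vanishes, but nothing is
   bought; a coverable arrival makes both positive. *)
case: s cs o0 => [|e s] cs o0.
  under eq_avg do rewrite chosen_nil objective0.
  rewrite avg_cst; last exact: grid_gt0.
  apply: mulr_ge0 o0; apply: mulr_ge0 rb0; apply: mulr_ge0; first exact: ler0n.
  by apply: exprn_ge0; exact: expR_ge0.
apply: le_trans (avg_objective_chosen cs) _; rewrite ler_wpM2r//.
have r_gt0 : (0 < #|ground I|)%N by apply/card_gt0P; exists e.
have f_gt0 : (0 < max_frequency I)%N.
  have : coverable [:: e] by apply: coverable_mem cs _; rewrite mem_head.
  rewrite /coverable /covers /= andbT => /existsP[j /andP[_ ej]].
  apply: leq_trans (leq_bigmax (F := fun e => #|[set j | e \in sets j]%SET|) e).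
  by apply/card_gt0P; exists j; rewrite inE.
have dE : d = max_frequency I by apply/maxn_idPr.
have b := boost_le r_gt0; have h := ln1Dn_ge_half R f_gt0.
rewrite dE /ratio_bound.
set Ld := ln (1 + _) in h *; set Lr := ln (1 + _) in b *.
have hd : 1 + Ld <= 3 * Ld by lra.
have Lr0 : 0 <= Lr by exact: ln0.
(* As [ln (1 + p) <= p], the quadratic dependence on [p] fits the claimed ratio. *)
have pp : p ^+ 2 <= p ^+ 3 / ln (1 + p).
  rewrite ler_pdivlMr// [leRHS]exprSr ler_wpM2l ?exprn_ge0 ?(ltW p_gt0)//.
  by rewrite le_ln1Dx// (lt_trans _ p_gt0)// ltrN10.
have E0 : 0 <= expR 1 :> R by exact: expR_ge0.
have step1 : (boost I)%:R * (1 + Ld) <= 3 * Lr * (3 * Ld).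
  by rewrite ler_pM// addr_ge0//; lra.
have step2 : p ^+ 2 * ((boost I)%:R * (1 + Ld)) <=
    p ^+ 3 / ln (1 + p) * (3 * Lr * (3 * Ld)).
  by rewrite ler_pM// ?exprn_ge0 ?(ltW p_gt0)// mulr_ge0// addr_ge0//; lra.
have step3 : 64 * expR 1 ^+ 2 * (p ^+ 2 * ((boost I)%:R * (1 + Ld))) <=
    64 * expR 1 ^+ 2 * (p ^+ 3 / ln (1 + p) * (3 * Lr * (3 * Ld))).
  by rewrite ler_wpM2l// mulr_ge0// exprn_ge0.
lra.
Qed.

End Analysis.

Theorem theorem3p3 (R : realType) :
  exists C : R, 0 < C /\
    exists alg : forall I : instance R, online_algorithm I,
      competitive (fun I => C * ratio_bound I) alg.
Proof.
exists (576 * expR 1 ^+ 2); split.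
  apply: mulr_gt0; first by rewrite ltr0n.
  by rewrite exprn_gt0 ?expR_gt0.
exists (fun I => threshold_algorithm I) => I s cs.
by rewrite expectation_chosen lee_fin competitive_chosen.
Qed.
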